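(* Let $\mathbb{K}$ be a field, let $\mathbb{L}$ be a field extension of $\mathbb{K}$, let $n$ be a positive integer and let $I$ be a set. Let $(A_i)_{i \in I}$ and $(B_i)_{i \in I}$ be two families of matrices of $\mathrm{M}_n(\mathbb{K})$. Then $(A_i)_{i \in I}$ and $(B_i)_{i \in I}$ are simultaneously similar in $\mathrm{M}_n(\mathbb{K})$ if and only if they are simultaneously similar in $\mathrm{M}_n(\mathbb{L})$.
   Context: For a field $\mathbb{F}$, $\mathrm{M}_n(\mathbb{F})$ denotes the $n\times n$ matrices over $\mathbb{F}$ and $\mathrm{GL}_n(\mathbb{F})$ the invertible ones. Two families $(A_i)_{i \in I}$ and $(B_i)_{i \in I}$ of matrices of $\mathrm{M}_n(\mathbb{F})$ indexed over the same set $I$ are simultaneously similar in $\mathrm{M}_n(\mathbb{F})$ when there exists a single $P \in \mathrm{GL}_n(\mathbb{F})$ such that $P A_i P^{-1} = B_i$ for all $i \in I$. Matrices over $\mathbb{K}$ are regarded as matrices over $\mathbb{L}$ via the inclusion $\mathbb{K} \subset \mathbb{L}$. The field extension is arbitrary (not assumed finite, algebraic or separable) and $I$ may be infinite. *)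

(* Defs.v *)
From mathcomp Require Import all_boot all_algebra.

Set Implicit Arguments.
Unset Strict Implicit.
Unset Printing Implicit Defensive.

Local Open Scope ring_scope.

(* [similar_in unitmx] only relates two single matrices, and [all_similar_to]
   takes a finite sequence and one target class; here the index type is
   arbitrary and each [A i] has its own target [B i]. *)
Definition simultaneously_similar (F : fieldType) (n : nat) (I : Type)
    (A B : I -> 'M[F]_n) : Prop :=
  exists2 P : 'M[F]_n, P \in unitmx & forall i : I, P *m A i *m invmx P = B i.

(* Main.v *)
Require Import Defs.
From HB Require Import structures.
From mathcomp Require Import all_boot all_algebra.
From mathcomp Require Import mxabelem boolp.

Set Implicit Arguments.
Unset Strict Implicit.
Unset Printing Implicit Defensive.

Import GRing.Theory.

Local Open Scope ring_scope.

(** Conjugating [A] into [B] amounts to finding an invertible matrix in the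
    space of intertwiners [P], those with [A i *m P = P *m B i] for all [i].
    These are homogeneous linear equations over [K], so the intertwiners over
    [L] are exactly the [L]-combinations of the intertwiners over [K]
    ([intertwiner_space]); infinitely many equations are harmless, because
    their common kernel is already cut out by finitely many of them.  What
    remains is to find an invertible [K]-combination, knowing that there is an
    invertible [L]-combination.

    If [K] is infinite, the determinant of a generic combination is a nonzero
    polynomial, so it does not vanish at some [K]-point: the coordinates are
    moved from [L] to [K] one at a time ([det_specialize]).

    If [K] is finite, that polynomial may vanish at every [K]-point, and the
    module structure has to be used.  View a family as a module over the free
    algebra on [I].  Similarity over [L] shows that, for every module [X], the
    spaces Hom(A, X) and Hom(B, X) have the same dimension, because these
    dimensions do not change under field extension; over a finite field they
    have the same cardinality ([leq_card_homs_ext]).  Sorting the morphisms by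
    their image gives
      #Hom(A, X) = sum over the submodules U of X of #Epi(A, U),
    so by induction on dim X the numbers of epimorphisms onto [X] agree too
    ([card_epis_eq]); this is the counting argument of Lovasz.  For [X] = [B]
    the identity is an epimorphism from [B], hence there is an epimorphism from
    [A] to [B], and it is invertible since both have dimension [n]. *)

(** * Intertwiners and extension of scalars *)

Definition intertwines (F : fieldType) (n m : nat) (I : Type)
    (A : I -> 'M[F]_n) (X : I -> 'M[F]_m) (f : 'M[F]_(n, m)) : Prop :=
  forall i, A i *m f = f *m X i.

Lemma intertwinesM (F : fieldType) (n m p : nat) (I : Type)
    (A : I -> 'M[F]_n) (B : I -> 'M[F]_m) (C : I -> 'M[F]_p) f g :
  intertwines A B f -> intertwines B C g -> intertwines A C (f *m g).
Proof. by move=> Af Bg i; rewrite mulmxA Af -!mulmxA Bg. Qed.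

Lemma intertwinesV (F : fieldType) (n : nat) (I : Type)
    (A B : I -> 'M[F]_n) P :
  P \in unitmx -> intertwines A B P -> intertwines B A (invmx P).
Proof.
by move=> uP AP i; rewrite -[B i](mulKmx uP) -AP mulmxA mulmxK.
Qed.

Lemma similar_intertwines (F : fieldType) (n : nat) (I : Type)
    (A B : I -> 'M[F]_n) :
  simultaneously_similar A B <->
  exists2 P : 'M[F]_n, P \in unitmx & intertwines A B P.
Proof.
split=> -[P uP PA].
  exists (invmx P); rewrite ?unitmx_inv //.
  by apply: intertwinesV => // i; rewrite -PA mulmxKV.
exists (invmx P); rewrite ?unitmx_inv // => i.
by rewrite invmxK -(intertwinesV uP PA) mulmxKV.
Qed.

(** The subspace [H] cut out by a possibly infinite family of linear equations
    is compatible with extension of scalars.  Kernels and intersections are, so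
    it suffices to start from the whole space and to intersect with
    [kermx (C i)] as long as some [C i] does not vanish on the current [H]; each
    time the rank drops, so the process stops. *)
Lemma common_kernel (K : fieldType) (p q : nat) (I : Type)
    (C : I -> 'M[K]_(p, q)) :
  exists H : 'M[K]_p,
    (forall i, H *m C i = 0) /\
    forall (L : fieldType) (iota : {rmorphism K -> L}) (k : nat)
           (u : 'M[L]_(k, p)),
      (forall i, u *m map_mx iota (C i) = 0) -> (u <= map_mx iota H)%MS.
Proof.
pose absorbs (H : 'M[K]_p) :=
  forall (L : fieldType) (iota : {rmorphism K -> L}) (k : nat)
         (u : 'M[L]_(k, p)),
    (forall i, u *m map_mx iota (C i) = 0) -> (u <= map_mx iota H)%MS.
have absorbs1 : absorbs 1%:M.
  by move=> L iota k u _; rewrite map_mx1 submx1.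
move: 1%:M absorbs1 => H.
have [r] := ubnP (\rank H); elim: r H => // r IHr H leHr absH.
have [HC|] := EM (forall i, H *m C i = 0); first by exists H.
move/existsNP=> [i HCi].
apply: (IHr (H :&: kermx (C i))%MS).
  apply: leq_trans (leHr : (\rank H <= r)%N).
  rewrite (ltn_leqif (mxrank_leqif_sup (capmxSl _ _))).
  by apply/negP; rewrite sub_capmx => /andP[_ /sub_kermxP].
move=> L iota k u uC; rewrite map_capmx sub_capmx map_kermx absH //=.
exact/sub_kermxP.
Qed.

(** Stating both sides over every extension of [K] makes the same [H] serve
    over [K] itself (through [idfun]) and over [L]. *)
Lemma intertwiner_space (K : fieldType) (n m : nat) (I : Type)
    (A : I -> 'M[K]_n) (X : I -> 'M[K]_m) :
  exists H : 'M[K]_(n * m),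
    forall (L : fieldType) (iota : {rmorphism K -> L}) (f : 'M[L]_(n, m)),
      intertwines (fun i => map_mx iota (A i)) (fun i => map_mx iota (X i)) f
      <-> (mxvec f <= map_mx iota H)%MS.
Proof.
pose defect (F : fieldType) (a : 'M[F]_n) (x : 'M[F]_m) :
    'M[F]_(n * m, n * m) := lin_mulmx a - lin_mulmxr x.
have defectE (F : fieldType) a x (f : 'M[F]_(n, m)) :
    mxvec f *m defect F a x = mxvec (a *m f - f *m x).
  by rewrite mulmxBr !mul_vec_lin linearB.
have map_defect (L : fieldType) (iota : {rmorphism K -> L}) a x :
    map_mx iota (defect K a x) = defect L (map_mx iota a) (map_mx iota x).
  by rewrite map_mxB; congr (_ - _); apply: map_lin_mx => f; exact: map_mxM.
have [H [HC absH]] := common_kernel (fun i => defect K (A i) (X i)).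
exists H => L iota f; split=> [Af | /submxP[u defu] i].
  by apply: absH => i; rewrite map_defect defectE Af subrr linear0.
apply/eqP; rewrite -subr_eq0 -(can_eq mxvecK) linear0 -defectE -map_defect.
by rewrite defu -mulmxA -map_mxM HC map_mx0 mulmx0.
Qed.

Lemma map_mx_idfun (K : fieldType) (m n : nat) (M : 'M[K]_(m, n)) :
  map_mx (idfun : {rmorphism K -> K}) M = M.
Proof. by apply: map_mx_id. Qed.

(** * Counting morphisms over a finite field *)

Lemma genmx_eq1 (F : fieldType) (n m : nat) (f : 'M[F]_(n, m)) :
  (<<f>>%MS == 1%:M) = row_full f.
Proof.
rewrite -sub1mx; apply/eqP/idP => [<- | f_full]; first by rewrite genmxE.
by rewrite -genmx1; apply/genmxP; rewrite submx1.
Qed.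

Section Counting.
Variables (F : finFieldType) (I : Type).

Definition homs (n m : nat) (A : I -> 'M[F]_n) (X : I -> 'M[F]_m) :
  {set 'M[F]_(n, m)} := [set f | `[< intertwines A X f >]].

Definition epis (n m : nat) (A : I -> 'M[F]_n) (X : I -> 'M[F]_m) :
  {set 'M[F]_(n, m)} := [set f in homs A X | row_full f].

Lemma homsP (n m : nat) (A : I -> 'M[F]_n) (X : I -> 'M[F]_m) f :
  reflect (intertwines A X f) (f \in homs A X).
Proof. by rewrite inE; apply: asboolP. Qed.

(** The hypothesis on [Q] makes [P] an epimorphism from [A] to [B] over [L], so
    composition with [P] embeds Hom(B, X) into Hom(A, X) over [L].  This
    compares the dimensions of these spaces, which are the same over [F], and
    hence their cardinalities over [F]. *)
Lemma leq_card_homs_ext (L : fieldType) (iota : {rmorphism F -> L})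
    (n1 n2 m : nat) (A : I -> 'M[F]_n1) (B : I -> 'M[F]_n2)
    (X : I -> 'M[F]_m) (P : 'M[L]_(n1, n2)) (Q : 'M[L]_(n2, n1)) :
  Q *m P = 1%:M ->
  intertwines (fun i => map_mx iota (A i)) (fun i => map_mx iota (B i)) P ->
  (#|homs B X| <= #|homs A X|)%N.
Proof.
move=> QP AP.
have card_homs n (D : I -> 'M[F]_n) (H : 'M[F]_(n * m)) :
    (forall (M : fieldType) (phi : {rmorphism F -> M}) (f : 'M[M]_(n, m)),
      intertwines (fun i => map_mx phi (D i)) (fun i => map_mx phi (X i)) f
      <-> (mxvec f <= map_mx phi H)%MS) ->
    #|homs D X| = (#|F| ^ \rank H)%N.
  move=> HP; rewrite -card_rowg -(card_imset _ (can_inj (@mxvecK F n m))).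
  apply: eq_card => u; rewrite mem_rowg; apply/imsetP/idP => [[f /homsP Df ->]|].
    by rewrite -[H]map_mx_idfun; apply/HP => i; rewrite !map_mx_idfun.
  rewrite -[u]vec_mxK -{1}[H]map_mx_idfun => /HP Df; exists (vec_mx u) => //.
  by apply/homsP => i; have := Df i; rewrite !map_mx_idfun.
have [HA HAP] := intertwiner_space A X; have [HB HBP] := intertwiner_space B X.
rewrite (card_homs _ _ _ HAP) (card_homs _ _ _ HBP).
apply: leq_pexp2l; first by apply/card_gt0P; exists 0.
rewrite -(mxrank_map iota HA) -(mxrank_map iota HB).
(* [lin_mulmx P] is the matrix of the composition with [P]. *)
have free_P : row_free (lin_mulmx P : 'M[L]_(n2 * m, n1 * m)).
  apply/row_freeP; exists (lin_mulmx Q); apply/row_matrixP => k.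
  rewrite !rowE mulmx1 -[delta_mx _ _]vec_mxK mulmxA !mul_vec_lin /=.
  by rewrite mulmxA QP mul1mx.
rewrite -(mxrankMfree _ free_P); apply/mxrankS/row_subP => k.
rewrite row_mul -[row k _]vec_mxK mul_vec_lin /=.
by apply/HAP/(intertwinesM AP)/HBP; rewrite vec_mxK row_sub.
Qed.

(** A submodule [U] of [X] is a row space, made unique by [<<U>> = U]; in the
    basis [row_base U] the family acts on it by [Y].  Morphisms with image [U]
    factor uniquely through [row_base U], by an epimorphism onto [Y]. *)
Lemma card_homs_image (n m : nat) (A : I -> 'M[F]_n) (X : I -> 'M[F]_m)
    (U : 'M[F]_m) (Y : I -> 'M[F]_(\rank U)) :
  <<U>>%MS = U -> intertwines Y X (row_base U) ->
  #|[set f in homs A X | <<f>>%MS == U]| = #|epis A Y|.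
Proof.
move=> genU YX; set R := row_base U.
have freeR : row_free R by exact: row_base_free.
rewrite -(card_imset _ (can_inj (mulmxKp freeR))).
apply: eq_card => f; apply/idP/imsetP => [|[g]].
  rewrite inE => /andP[/homsP Af /eqP fU].
  have fR : f *m pinvmx R *m R = f.
    by apply: mulmxKpV; rewrite eq_row_base -fU genmxE.
  exists (f *m pinvmx R) => //; rewrite inE; apply/andP; split.
    apply/homsP => i; apply: (row_free_inj freeR).
    rewrite /= -[LHS]mulmxA fR -[RHS]mulmxA [Y i *m R]YX.
    by rewrite [RHS]mulmxA fR Af.
  by rewrite /row_full -(mxrankMfree _ freeR) fR -mxrank_gen fU.
rewrite !inE => /andP[/asboolP Ag full_g] ->; apply/andP; split.
  by apply/asboolP/(intertwinesM Ag).
by rewrite -{2}genU; apply/eqP/eq_genmx/(eqmx_trans (eqmxMfull _ full_g))/eq_row_base.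
Qed.

(** The image of a morphism is a submodule of [X]. *)
Lemma submodule_of_image (n m : nat) (A : I -> 'M[F]_n) (X : I -> 'M[F]_m) f :
  f \in homs A X ->
  exists Y : I -> 'M[F]_(\rank <<f>>), intertwines Y X (row_base <<f>>%MS).
Proof.
move=> /homsP Af; set R := row_base <<f>>%MS.
exists (fun i => R *m X i *m pinvmx R) => i; rewrite mulmxKpV //.
rewrite (eqmxMr _ (eq_row_base _)) (eqmxMr _ (genmxE _)) eq_row_base.
by rewrite genmxE -Af submxMl.
Qed.

(** In the partition of Hom(A, X) by images, the proper submodules of [X]
    contribute equally for [A] and [B] by induction on the dimension, so the
    remaining terms, which count the epimorphisms onto [X], agree as well. *)
Lemma card_epis_eq (n1 n2 : nat) (A : I -> 'M[F]_n1) (B : I -> 'M[F]_n2) :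
  (forall m (X : I -> 'M[F]_m), #|homs A X| = #|homs B X|) ->
  forall m (X : I -> 'M[F]_m), #|epis A X| = #|epis B X|.
Proof.
move=> eqAB m; have [r] := ubnP m; elim: r m => // r IHr m lemr X.
have by_image n (D : I -> 'M[F]_n) :
    #|homs D X| = (#|epis D X| + \sum_(U : 'M[F]_m | U != 1%:M)
                    #|[set f in homs D X | <<f>>%MS == U]|)%N.
  rewrite -sum1_card (partition_big (fun f => <<f>>%MS) predT) //=.
  rewrite (bigD1 1%:M) //=; congr (_ + _)%N.
    rewrite sum1_card; apply: eq_card => f; rewrite [RHS]inE; congr (_ && _).
    exact: genmx_eq1.
  by apply: eq_bigr => U _; rewrite sum1dep_card; apply: eq_card => f; rewrite !inE.
have := eqAB m X; rewrite !by_image.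
rewrite (eq_bigr (fun U => #|[set f in homs B X | <<f>>%MS == U]|)) => [/addIn//|].
move=> U neqU1.
have [[genU [Y YX]] | noY] := EM (<<U>>%MS = U /\
    exists Y : I -> 'M[F]_(\rank U), intertwines Y X (row_base U)).
  rewrite !(card_homs_image _ genU YX); apply: IHr.
  apply: leq_trans (lemr : (m <= r)%N); rewrite ltn_neqAle rank_leq_row andbT.
  by apply: contra neqU1 => fullU; rewrite -genU genmx_eq1.
(* [U] is not a submodule of [X], so it is not the image of any morphism. *)
have empty n (D : I -> 'M[F]_n) : #|[set f in homs D X | <<f>>%MS == U]| = 0%N.
  apply: eq_card0 => f; rewrite inE; apply/negP => /andP[/submodule_of_image Df].
  by move/eqP=> fU; apply: noY; rewrite -fU genmx_id.
by rewrite !empty.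
Qed.

Lemma finite_field_descent (L : fieldType) (iota : {rmorphism F -> L})
    (n : nat) (A B : I -> 'M[F]_n) (P : 'M[L]_n) :
  P \in unitmx ->
  intertwines (fun i => map_mx iota (A i)) (fun i => map_mx iota (B i)) P ->
  exists2 Q : 'M[F]_n, Q \in unitmx & intertwines A B Q.
Proof.
move=> uP AP.
have eq_homs m (X : I -> 'M[F]_m) : #|homs A X| = #|homs B X|.
  apply/eqP; rewrite eqn_leq (leq_card_homs_ext _ (mulVmx uP) AP).
  by rewrite (leq_card_homs_ext _ (mulmxV uP) (intertwinesV uP AP)).
have: (0 < #|epis A B|)%N.
  rewrite (card_epis_eq eq_homs); apply/card_gt0P; exists 1%:M.
  by rewrite !inE row_full_unit unitmx1 andbT; apply/asboolP => i; rewrite mulmx1 mul1mx.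
case/card_gt0P=> Q; rewrite !inE row_full_unit => /andP[/asboolP AQ uQ].
by exists Q.
Qed.

End Counting.

(** The equality of structures, rather than of carriers, lets a statement about
    [K] be replaced by the same statement about [F]. *)
Lemma finFieldType_of_enum (K : fieldType) (s : seq K) :
  (forall x, x \in s) -> exists F : finFieldType, F = K :> fieldType.
Proof.
case: K s => T cT s sP; pose K : fieldType := GRing.Field.Pack cT.
have pK : pcancel (fun x : K => index x s) (onth s).
  by move=> x; rewrite onthE (nth_map x) ?index_mem ?nth_index.
have sE : @Finite.axiom K (undup s).
  by move=> x; rewrite count_uniq_mem ?undup_uniq // mem_undup sP.
pose cM := Choice_isCountable.Build K pK.
pose fM := isFinite.Build K sE.
pose F : finFieldType := HB.pack K cM fM.
(* Both sides repackage the same operations, but as records without eta they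
   become convertible only once the class [cT] is taken apart. *)
by exists F; destruct cT.
Qed.

(** * Specialization over an infinite field *)

Lemma infinite_field_nonroot (K L : fieldType) (iota : {rmorphism K -> L})
    (p : {poly L}) :
  (forall s : seq K, exists x, x \notin s) -> p != 0 ->
  exists x : K, p.[iota x] != 0.
Proof.
move=> infK p_neq0; apply: contrapT => /forallNP noroot.
have [s [us sizes]] : exists s : seq K, uniq s /\ size s = size p.
  elim: (size p) => [|k [s [us <-]]]; first by exists [::].
  by have [x xs] := infK s; exists (x :: s); rewrite /= xs us.
have roots_s : all (root p) (map iota s).
  by apply/allP => _ /mapP[x _ ->]; apply/negPn/negP/noroot.
have := max_poly_roots p_neq0 roots_s.
by rewrite size_map sizes ltnn map_inj_uniq ?us => [/(_ isT)|]; last exact: fmorph_inj.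
Qed.

(** Only one coordinate moves at a time, so polynomials in one variable suffice:
    once the first coordinate is replaced by some [y0] in [K], its term is
    absorbed in the constant matrix [C], which is why [C] is there. *)
Lemma det_specialize (K L : fieldType) (iota : {rmorphism K -> L})
    (n d : nat) (C : 'M[K]_n) (M : 'I_d -> 'M[K]_n) (x : 'I_d -> L) :
  (forall s : seq K, exists y, y \notin s) ->
  \det (map_mx iota C + \sum_k x k *: map_mx iota (M k)) != 0 ->
  exists y : 'I_d -> K, \det (C + \sum_k y k *: M k) != 0.
Proof.
move=> infK; elim: d => [|d IHd] in C M x *.
  rewrite big_ord0 addr0 det_map_mx fmorph_eq0 => detC.
  by exists (fun=> 0); rewrite big_ord0 addr0.
rewrite big_ord_recl; set S := \sum_(k < d) _ => det_x.
pose p : {poly L} := \det (map_mx polyC (map_mx iota C + S)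
                           + 'X *: map_mx polyC (map_mx iota (M ord0))).
have pE t : p.[t] = \det (map_mx iota C + (t *: map_mx iota (M ord0) + S)).
  rewrite -/(horner_eval t p) -det_map_mx; congr (\det _); apply/matrixP=> i j.
  by rewrite !mxE /= /horner_eval !hornerE addrAC.
have /(infinite_field_nonroot iota infK)[y0] : p != 0.
  by apply: contraNneq det_x => p0; rewrite -pE p0 horner0.
rewrite pE addrA -map_mxZ -map_mxD => /IHd[y det_y].
exists (fun k => if unlift ord0 k is Some j then y j else y0).
rewrite big_ord_recl unlift_none addrA.
by under eq_bigr do rewrite liftK.
Qed.

Lemma infinite_field_descent (K L : fieldType) (iota : {rmorphism K -> L})
    (n : nat) (I : Type) (A B : I -> 'M[K]_n) (P : 'M[L]_n) :
  (forall s : seq K, exists x, x \notin s) ->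
  P \in unitmx ->
  intertwines (fun i => map_mx iota (A i)) (fun i => map_mx iota (B i)) P ->
  exists2 Q : 'M[K]_n, Q \in unitmx & intertwines A B Q.
Proof.
move=> infK uP AP; have [H HP] := intertwiner_space A B.
have /submxP[u defP] := (HP L iota P).1 AP.
pose M k := vec_mx (row k H) : 'M[K]_n.
have [|y det_y] := @det_specialize K L iota n _ 0 M (u 0) infK.
  suff -> : map_mx iota 0 + \sum_k u 0 k *: map_mx iota (M k) = P.
    by move: uP; rewrite unitmxE unitfE.
  rewrite map_mx0 add0r -[RHS]mxvecK defP mulmx_sum_row linear_sum /=.
  by apply: eq_bigr => k _; rewrite linearZ /= -map_row map_vec_mx.
exists (\sum_k y k *: M k); first by rewrite unitmxE unitfE -[X in \det X]add0r.
suff AQ : (mxvec (\sum_k y k *: M k) <= map_mx (idfun : {rmorphism K -> K}) H)%MS.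
  by move=> i; have := (HP K idfun _).2 AQ i; rewrite !map_mx_idfun.
rewrite map_mx_idfun linear_sum /=; apply: summx_sub => k _.
by rewrite linearZ /= vec_mxK scalemx_sub ?row_sub.
Qed.

(** * Descent of simultaneous similarity *)

Theorem theorem1 (K L : fieldType) (iota : {rmorphism K -> L})
    (n : nat) (n_gt0 : (0 < n)%N) (I : Type) (A B : I -> 'M[K]_n) :
  simultaneously_similar A B <->
  simultaneously_similar (fun i => map_mx iota (A i))
                         (fun i => map_mx iota (B i)).
Proof.
split=> [[P uP PA] | /similar_intertwines[P uP AP]].
  exists (map_mx iota P); rewrite ?map_unitmx // => i.
  by rewrite -map_invmx -!map_mxM PA.
apply/similar_intertwines.
have [infK | /existsNP[s /forallNP sP]] :=
  EM (forall s : seq K, exists x, x \notin s).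
  exact: infinite_field_descent AP.
have [|F eqFK] := @finFieldType_of_enum K s.
  by move=> x; apply: contrapT => /negP; apply: sP.
by case: K / eqFK in iota A B AP {s sP} *; apply: finite_field_descent AP.
Qed.
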